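(* Let $G^{\varphi}=(G,U(\mathbb{Q}),\varphi)$ be a $U(\mathbb{Q})$-gain graph of order $n$ with maximum degree $\Delta$, and suppose $G^{\varphi}$ has no isolated vertices. Then $r(G^{\varphi})=\frac{n}{\Delta}$ if and only if $G^{\varphi}=\frac{n}{2\Delta}K^{\varphi}_{\Delta,\Delta}$ (that is, the underlying graph $G$ is a disjoint union of $\frac{n}{2\Delta}$ copies of the complete bipartite graph $K_{\Delta,\Delta}$) and each 4-cycle $C^{\varphi}_{4}$ (if any) in each of these components $K^{\varphi}_{\Delta,\Delta}$ is of Type 1.
   Context: $\mathbb{Q}$ denotes the skew field of real quaternions $q=x_0+x_1i+x_2j+x_3k$ ($x_0,\dots,x_3\in\mathbb{R}$), with conjugate $\bar q=x_0-x_1i-x_2j-x_3k$ and modulus $|q|=\sqrt{q\bar q}$; $U(\mathbb{Q})=\{q\in\mathbb{Q}:|q|=1\}$ is the multiplicative group of unit quaternions. A $U(\mathbb{Q})$-gain graph (quaternion unit gain graph) $G^{\varphi}=(G,U(\mathbb{Q}),\varphi)$ consists of a finite simple graph $G$ with vertices $v_1,\dots,v_n$ ($n\ge 1$ is the order) and a gain function $\varphi$ assigning to each oriented edge $e_{ij}$ (from $v_i$ to $v_j$, where $v_iv_j\in E(G)$; both orientations $e_{ij}$ and $e_{ji}$ of each edge are considered) an element $\varphi(e_{ij})=\varphi_{v_iv_j}\in U(\mathbb{Q})$ such that $\varphi(e_{ij})=\varphi(e_{ji})^{-1}=\overline{\varphi(e_{ji})}$. Its adjacency matrix $A(G^{\varphi})$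 is the Hermitian $n\times n$ quaternion matrix with $(i,j)$ entry $\varphi(e_{ij})$ if $v_i$ and $v_j$ are adjacent and $0$ otherwise. The rank $r(G^{\varphi})$ is the row left rank of $A(G^{\varphi})$, i.e. the maximum number of rows of $A(G^{\varphi})$ that are left linearly independent (with respect to combinations $\sum_i q_i\alpha_i$ of rows $\alpha_i$ with quaternion coefficients $q_i$ multiplying on the left). Degrees of vertices, isolated vertices and the maximum degree $\Delta$ of $G^{\varphi}$ are those of the underlying graph $G$. $K^{\varphi}_{a,b}$ denotes a $U(\mathbb{Q})$-gain graph whose underlying graph is the complete bipartite graph $K_{a,b}$ (the gains on different components need not agree). A 4-cycle $C_4^{\varphi}$ with consecutive vertices $u_1,u_2,u_3,u_4$ is of Type 1 if $\varphi_{u_1u_2}\varphi_{u_2u_3}\varphi_{u_3u_4}\varphi_{u_4u_1}=1$ (this does not depend on the starting vertex or the direction). *)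

(* Defs.v *)
From HB Require Import structures.
From mathcomp Require Import all_boot all_order all_algebra.
From mathcomp Require Import boolp reals.
From mathcomp Require Import ring.

Set Implicit Arguments.
Unset Strict Implicit.
Unset Printing Implicit Defensive.

Import Order.TTheory GRing.Theory Num.Theory.
Local Open Scope ring_scope.

(* [Quat a b c d] is a + b i + c j + d k. *)
Record quat (R : realType) := Quat { q0 : R; q1 : R; q2 : R; q3 : R }.

Section Quaternions.
Variable R : realType.
Implicit Types p q r : quat R.

Definition quat_tuple q : R * R * R * R := (q0 q, q1 q, q2 q, q3 q).
Definition tuple_quat (t : R * R * R * R) : quat R :=
  let: (a, b, c, d) := t in Quat a b c d.

Lemma quat_tupleK : cancel quat_tuple tuple_quat.
Proof. by case. Qed.

HB.instance Definition _ := Equality.copy (quat R) (can_type quat_tupleK).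
HB.instance Definition _ := Choice.copy (quat R) (can_type quat_tupleK).

Definition addq p q :=
  Quat (q0 p + q0 q) (q1 p + q1 q) (q2 p + q2 q) (q3 p + q3 q).
Definition oppq q := Quat (- q0 q) (- q1 q) (- q2 q) (- q3 q).
Definition mulq p q := Quat
  (q0 p * q0 q - q1 p * q1 q - q2 p * q2 q - q3 p * q3 q)
  (q0 p * q1 q + q1 p * q0 q + q2 p * q3 q - q3 p * q2 q)
  (q0 p * q2 q - q1 p * q3 q + q2 p * q0 q + q3 p * q1 q)
  (q0 p * q3 q + q1 p * q2 q - q2 p * q1 q + q3 p * q0 q).

Fact addqA : associative addq.
Proof. by move=> [? ? ? ?] [? ? ? ?] [? ? ? ?]; congr Quat => /=; ring. Qed.
Fact addqC : commutative addq.
Proof. by move=> [? ? ? ?] [? ? ? ?]; congr Quat => /=; ring. Qed.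
Fact add0q : left_id (Quat 0 0 0 0) addq.
Proof. by move=> [? ? ? ?]; congr Quat => /=; ring. Qed.
Fact addNq : left_inverse (Quat 0 0 0 0) oppq addq.
Proof. by move=> [? ? ? ?]; congr Quat => /=; ring. Qed.

HB.instance Definition _ :=
  GRing.isZmodule.Build (quat R) addqA addqC add0q addNq.

Fact mulqA : associative mulq.
Proof. by move=> [? ? ? ?] [? ? ? ?] [? ? ? ?]; congr Quat => /=; ring. Qed.
Fact mul1q : left_id (Quat 1 0 0 0) mulq.
Proof. by move=> [? ? ? ?]; congr Quat => /=; ring. Qed.
Fact mulq1 : right_id (Quat 1 0 0 0) mulq.
Proof. by move=> [? ? ? ?]; congr Quat => /=; ring. Qed.
Fact mulqDl : left_distributive mulq +%R.
Proof. by move=> [? ? ? ?] [? ? ? ?] [? ? ? ?]; congr Quat => /=; ring. Qed.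
Fact mulqDr : right_distributive mulq +%R.
Proof. by move=> [? ? ? ?] [? ? ? ?] [? ? ? ?]; congr Quat => /=; ring. Qed.
Fact oneq_neq0 : Quat 1 0 0 0 != 0 :> quat R.
Proof. by apply/eqP => -[/eqP]; rewrite oner_eq0. Qed.

HB.instance Definition _ := GRing.Zmodule_isNzRing.Build (quat R)
  mulqA mul1q mulq1 mulqDl mulqDr oneq_neq0.

Definition conjq q : quat R := Quat (q0 q) (- q1 q) (- q2 q) (- q3 q).

(* The product of q and its conjugate is real (see mulq_conj), so its first
   coordinate is the whole product. *)
Definition normq q : R := Num.sqrt (q0 (q * conjq q)).

Definition sqnormq q : R := q0 q ^+ 2 + q1 q ^+ 2 + q2 q ^+ 2 + q3 q ^+ 2.

Definition invq q : quat R := let s := (sqnormq q)^-1 in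
  Quat (s * q0 q) (- (s * q1 q)) (- (s * q2 q)) (- (s * q3 q)).

Lemma mulq_conj q : q * conjq q = Quat (sqnormq q) 0 0 0.
Proof. by case: q => a b c d; congr Quat; rewrite /sqnormq /=; ring. Qed.

Lemma sqnormq_eq0 q : (sqnormq q == 0) = (q == 0).
Proof.
apply/idP/eqP => [|->]; last by rewrite /sqnormq /= !expr0n /= !addr0.
case: q => a b c d; rewrite /sqnormq /=.
rewrite !paddr_eq0 ?addr_ge0 ?sqr_ge0 // !sqrf_eq0.
by move=> /andP[/andP[/andP[/eqP-> /eqP->] /eqP->] /eqP->].
Qed.

Fact mulVq : {in [pred q : quat R | q != 0], left_inverse 1 invq *%R}.
Proof.
move=> q; rewrite inE -sqnormq_eq0 => qn0.
have sE : (sqnormq q)^-1 * sqnormq q = 1 by rewrite mulVf.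
case: q qn0 sE => a b c d; rewrite /invq /= => _.
set s := (sqnormq _)^-1; rewrite /sqnormq /= => sE.
by congr Quat => /=; [apply: etrans sE; ring | ring | ring | ring].
Qed.

Fact mulqV : {in [pred q : quat R | q != 0], right_inverse 1 invq *%R}.
Proof.
move=> q; rewrite inE -sqnormq_eq0 => qn0.
have sE : (sqnormq q)^-1 * sqnormq q = 1 by rewrite mulVf.
case: q qn0 sE => a b c d; rewrite /invq /= => _.
set s := (sqnormq _)^-1; rewrite /sqnormq /= => sE.
by congr Quat => /=; [apply: etrans sE; ring | ring | ring | ring].
Qed.

Fact quat_unitP p q : q * p = 1 /\ p * q = 1 -> p != 0.
Proof.
by case=> qp _; apply/eqP => p0; move/eqP: qp; rewrite p0 mulr0 eq_sym oner_eq0.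
Qed.

Fact invq_out : {in [predC [pred q : quat R | q != 0]], invq =1 id}.
Proof.
move=> q; rewrite !inE negbK => /eqP->.
by congr Quat; rewrite /= mulr0 ?oppr0.
Qed.

HB.instance Definition _ := GRing.NzRing_hasMulInverse.Build (quat R)
  mulVq mulqV quat_unitP invq_out.

Definition unit_quat : {pred quat R} := [pred q | normq q == 1].

Lemma unit_quat_inv q : q \in unit_quat -> q^-1 = conjq q.
Proof.
rewrite inE /normq mulq_conj /= => /eqP nq1.
have s_ge0 : 0 <= sqnormq q by rewrite !addr_ge0 ?sqr_ge0.
have s1 : sqnormq q = 1 by rewrite -(sqr_sqrtr s_ge0) nq1 expr1n.
by rewrite /GRing.inv /= /invq /conjq s1 invr1 !mul1r.
Qed.

End Quaternions.

Arguments unit_quat {R}.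

Section LeftRank.
Variable H : nzRingType.

Definition rows_left_independent m n (A : 'M[H]_(m, n)) (S : {set 'I_m}) :=
  forall c : 'I_m -> H,
    \sum_(i in S) c i *: row i A = 0 -> forall i, i \in S -> c i = 0.

Definition left_rank m n (A : 'M[H]_(m, n)) : nat :=
  \max_(S : {set 'I_m} | `[< rows_left_independent A S >]) #|S|.

End LeftRank.

Record sgraph (V : finType) := SGraph {
  adj :> rel V;
  adj_sym : symmetric adj;
  adj_irr : irreflexive adj }.

Definition degree (V : finType) (G : sgraph V) (v : V) : nat :=
  #|[set w | adj G v w]|.

Definition max_degree (V : finType) (G : sgraph V) : nat :=
  \max_(v : V) degree G v.

Definition isolated (V : finType) (G : sgraph V) (v : V) : Prop :=
  forall w, ~~ adj G v w.

Definition isomorphic (V W : finType) (G : sgraph V) (H : sgraph W) : Prop :=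
  exists f : V -> W, bijective f /\ forall x y, adj H (f x) (f y) = adj G x y.

Section CompleteBipartite.
Variables a b : nat.

Definition Kab_adj : rel ('I_a + 'I_b) := fun x y =>
  match x, y with
  | inl _, inr _ | inr _, inl _ => true
  | _, _ => false
  end.

Fact Kab_sym : symmetric Kab_adj. Proof. by case=> ? []. Qed.
Fact Kab_irr : irreflexive Kab_adj. Proof. by case. Qed.

Definition complete_bipartite : sgraph ('I_a + 'I_b)%type :=
  SGraph Kab_sym Kab_irr.

End CompleteBipartite.

(* [copies m G] is the disjoint union of m copies of G. *)
Section Copies.
Variables (m : nat) (V : finType) (G : sgraph V).

Definition copies_adj : rel ('I_m * V) :=
  fun x y => (x.1 == y.1) && adj G x.2 y.2.

Fact copies_sym : symmetric copies_adj.
Proof. by move=> x y; rewrite /copies_adj eq_sym adj_sym. Qed.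
Fact copies_irr : irreflexive copies_adj.
Proof. by move=> x; rewrite /copies_adj adj_irr andbF. Qed.

Definition copies : sgraph ('I_m * V)%type := SGraph copies_sym copies_irr.

End Copies.

(* [gain u v] is only meaningful when u and v are adjacent; its values on other
   pairs are unconstrained and are never used. *)
Record gain_graph (R : realType) (n : nat) := GainGraph {
  underlying :> sgraph 'I_n;
  gain : 'I_n -> 'I_n -> quat R;
  gain_unit : forall u v, adj underlying u v -> gain u v \in unit_quat;
  gain_inv : forall u v, adj underlying u v -> gain u v = (gain v u)^-1 }.

Section GainGraphs.
Variables (R : realType) (n : nat) (G : gain_graph R n).

Definition adjacency : 'M[quat R]_n :=
  \matrix_(i, j) if adj G i j then gain G i j else 0.

Definition rank : nat := left_rank adjacency.

Definition four_cycle (u1 u2 u3 u4 : 'I_n) : Prop :=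
  ucycle (adj G) [:: u1; u2; u3; u4].

Definition type1 (u1 u2 u3 u4 : 'I_n) : Prop :=
  gain G u1 u2 * gain G u2 u3 * gain G u3 u4 * gain G u4 u1 = 1.

Lemma adjacency_hermitian : (map_mx (@conjq R) adjacency)^T = adjacency.
Proof.
apply/matrixP => i j; rewrite !mxE adj_sym; case: ifP => [ij|_].
  have ji : adj G j i by rewrite adj_sym.
  by rewrite -unit_quat_inv ?gain_unit // -gain_inv.
by congr Quat; rewrite oppr0.
Qed.

End GainGraphs.

(* Main.v *)
Require Import Defs.
From mathcomp Require Import all_boot all_order all_algebra.
From mathcomp Require Import boolp reals.
From mathcomp Require Import zify.

Set Implicit Arguments.
Unset Strict Implicit.
Unset Printing Implicit Defensive.

(** A maximum left independent set S of rows spans all rows, so every vertex has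
    a neighbour in S (its column is nonzero), and counting edges leaving S gives
    n <= r * Delta.  In case of equality the neighbourhoods of the vertices of S
    have size Delta and partition the vertex set; every row is then a multiple of
    a single row of S.  Hence two vertices with a common neighbour have
    proportional rows, and in particular equal neighbourhoods, which forces both
    the K_{Delta,Delta} components and the type 1 condition.  Conversely, type 1
    makes rows in the same part of a component proportional, so r <= 2m. *)

Import GRing.Theory Num.Theory.
Local Open Scope ring_scope.

(** * Left rank over a ring whose nonzero elements are units *)

Section DivisionRingRank.
Variables (H : unitRingType) (m n : nat) (A : 'M[H]_(m, n)).
Hypothesis unit_neq0 : forall x : H, x != 0 -> x \is a GRing.unit.

Lemma left_rank_witness :
  exists2 S, rows_left_independent A S & #|S| = left_rank A.
Proof.
have P0 : `[< rows_left_independent A set0 >].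
  by apply/asboolP => c _ i; rewrite inE.
have [|S /asboolP indS eS] := @eq_bigmax_cond _
    [pred S : {set 'I_m} | `[< rows_left_independent A S >]] (fun S => #|S|).
  by apply/card_gt0P; exists set0.
by exists S; rewrite /left_rank ?eS.
Qed.

Lemma independent_leq_rank (S : {set 'I_m}) :
  rows_left_independent A S -> (#|S| <= left_rank A)%N.
Proof. by move=> indS; apply: leq_bigmax_cond; apply/asboolP. Qed.

(** For [i] outside [S], maximality yields a relation involving row [i]; independence of [S] makes
    its coefficient nonzero, and left division by it solves for the row. *)
Lemma maximum_independent_spans (S : {set 'I_m}) (i : 'I_m) :
  rows_left_independent A S -> #|S| = left_rank A ->
  exists c : 'I_m -> H, row i A = \sum_(s in S) c s *: row s A.
Proof.
move=> indS cardS; have [iS|iNS] := boolP (i \in S).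
  exists (fun s => (s == i)%:R); rewrite (bigD1 i) //= eqxx scale1r.
  by rewrite big1 ?addr0 // => s /andP[_ /negPf->]; rewrite scale0r.
have : ~ rows_left_independent A (i |: S).
  by move/independent_leq_rank; rewrite cardsU1 iNS -cardS ltnn.
move/existsNP => [c /not_implyP[]]; rewrite big_setU1 //= => c0.
move/existsNP => [j /not_implyP[jiS cj]].
have ci : c i \is a GRing.unit.
  apply/unit_neq0/eqP => ci0; apply: cj; move: jiS; rewrite in_setU1.
  case/predU1P => [->//|]; apply: indS.
  by move: c0; rewrite ci0 scale0r add0r.
exists (fun s => - (c i)^-1 * c s).
under eq_bigr do rewrite -scalerA.
rewrite -scaler_sumr scaleNr -scalerN.
rewrite -(addr0_eq c0) opprK.
by apply/rowP => k; rewrite !mxE mulKr.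
Qed.

Lemma independent_rows_not_proportional (S : {set 'I_m}) (i j : 'I_m) (c : H) :
  rows_left_independent A S -> i \in S -> j \in S ->
  row i A = c *: row j A -> i = j.
Proof.
move=> indS iS jS rij; apply/eqP/negP => /negP ij.
have := indS (fun s => if s == i then 1 else if s == j then - c else 0).
rewrite (bigD1 i) //= (bigD1 j) ?jS 1?eq_sym ?ij //= !eqxx eq_sym (negPf ij).
rewrite big1 => [|s /andP[/andP[_ /negPf->] /negPf->]]; last by rewrite scale0r.
rewrite addr0 scale1r rij scaleNr subrr => /(_ erefl i iS) /eqP.
by rewrite eqxx oner_eq0.
Qed.

End DivisionRingRank.

(** * Regular graphs in which a common neighbour makes twins *)

Section TwinGraphs.
Variables (V : finType) (G : sgraph V) (d : nat).
Hypothesis d_gt0 : (0 < d)%N.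
Hypothesis regG : forall v, degree G v = d.
Hypothesis common_nbr : forall u v x, G u x -> G v x -> G u =1 G v.

Let twin (u v : V) := [forall x, G u x == G v x].

Let twinP u v : reflect (G u =1 G v) (twin u v).
Proof. exact: 'forall_eqP. Qed.

Let nbr v : {w | G v w}.
Proof.
have : (0 < #|[set w | G v w]|)%N by rewrite -/(degree G v) regG.
by case/card_gt0P/sigW => w; rewrite inE; exists w.
Qed.

(** A vertex joined to [w] shares the neighbour [w] with [v], so [common_nbr] applies. This trades
    twin tests for adjacency tests. *)
Let twin_nbr v w x : G v w -> twin v x = G w x.
Proof.
move=> vw; apply/twinP/idP => [e|wx]; first by rewrite adj_sym -e.
by apply: (common_nbr vw); rewrite adj_sym.
Qed.

(** Membership in one component: the twins of [u] form its side, the neighbours of [u] the other. *)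
Let same u v := twin u v || G u v.

Let same_refl u : same u u.
Proof. by rewrite /same; apply/orP; left; apply/twinP. Qed.

Let same_left u v : same u v -> same u =1 same v.
Proof.
move=> uv x; have [w uw] := nbr u; have [w' vw'] := nbr v.
have [y wy] := nbr w; have [y' w'y'] := nbr w'.
move: uv; rewrite /same (twin_nbr _ uw) (twin_nbr _ vw') (twin_nbr _ uw).
rewrite -(twin_nbr v uw) => /orP[/twinP e|uv].
  rewrite e; congr (_ || _); rewrite -(twin_nbr x vw') -(twin_nbr x uw).
  by apply/twinP/twinP => E z; rewrite -E e.
(* For adjacent [u] and [v] the disjuncts swap: the twins of one are the neighbours of the other. *)
by rewrite -(twin_nbr x uw) (twin_nbr _ uv) orbC -(twin_nbr x vw')
  (twin_nbr (w := u)) // adj_sym.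
Qed.

(** [pick] respects extensional equality of predicates, so a whole component gets one
    representative; reflexivity of [same] rules out the default. *)
Let rep v := odflt v [pick x | same v x].

Let rep_same v : same v (rep v).
Proof. by rewrite /rep; case: pickP => //= /(_ v); rewrite same_refl. Qed.

Let same_rep u v : same u v -> rep u = rep v.
Proof.
move=> uv; rewrite /rep (eq_pick (same_left uv)).
by case: pickP => //= /(_ v); rewrite same_refl.
Qed.

Let reps : {set V} := [set rep v | v in V].

Let reps_same r r' : r \in reps -> r' \in reps -> same r r' -> r = r'.
Proof.
have fix_rep s : s \in reps -> rep s = s.
  by case/imsetP => v _ ->; rewrite -(same_rep (rep_same v)).
by move=> /fix_rep e /fix_rep e' /same_rep; rewrite e e'.
Qed.

Let part r (b : bool) : {set V} := if b then [set w | twin r w] else [set w | G r w].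

Let card_part r b : #|part r b| = d.
Proof.
case: b; last exact: regG.
have [w rw] := nbr r; rewrite -(regG w); apply: eq_card => x.
by rewrite !inE (twin_nbr x rw).
Qed.

(** An edge between like sides would make the representatives adjacent, hence equal, against
    irreflexivity; one between unlike sides makes them twins, hence equal. *)
Let adj_part r r' b b' x y : r \in reps -> r' \in reps ->
  x \in part r b -> y \in part r' b' -> G x y = (r == r') && (b != b').
Proof.
move=> rR r'R; have E := reps_same rR r'R.
have Ntt z z' : twin z z' -> G z z' = false.
  by move/twinP=> e; rewrite e adj_irr.
case: b; case: b'; rewrite !inE /= ?andbF ?andbT.
- move=> /twinP rx /twinP ry; rewrite -rx; apply/negP => rx'.
  have rr' : G r r' by rewrite adj_sym ry adj_sym.
  by move: (rr'); rewrite -E ?adj_irr // /same rr' orbT.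
- move=> /twinP rx ry; rewrite -rx; apply/idP/eqP => [rx'|->//].
  by apply: E; rewrite /same; apply/orP; left; apply/twinP/(common_nbr rx' ry).
- move=> rx /twinP ry; rewrite adj_sym -ry; apply/idP/eqP => [rx'|<-//].
  by apply: E; rewrite /same; apply/orP; left; apply/twinP/(common_nbr rx rx').
move=> rx ry; apply/negP => xy.
have rr' : G r r' by rewrite (common_nbr rx (_ : G y x)) // adj_sym.
by move: (rr'); rewrite -E ?adj_irr // /same rr' orbT.
Qed.

(** Both parts have exactly [d] elements, so [nth] never returns its default. *)
Let embed (p : 'I_#|reps| * ('I_d + 'I_d)) : V :=
  let r := enum_val p.1 in
  match p.2 with
  | inl a => nth r (enum (part r true)) a
  | inr a => nth r (enum (part r false)) a
  end.

Let side (s : 'I_d + 'I_d) : bool := if s is inl _ then true else false.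

Let embed_part p : embed p \in part (enum_val p.1) (side p.2).
Proof.
by case: p => i [] a; rewrite /embed -mem_enum mem_nth // -cardE card_part.
Qed.

Let embed_adj p q : G (embed p) (embed q) =
  copies #|reps| (complete_bipartite d d) p q.
Proof.
rewrite (adj_part (enum_valP p.1) (enum_valP q.1) (embed_part p) (embed_part q)).
rewrite (inj_eq enum_val_inj) /= /copies_adj.
by congr (_ && _); case: p.2; case: q.2.
Qed.

Let embed_inj : injective embed.
Proof.
move=> p q e.
have adjE z : copies #|reps| (complete_bipartite d d) p z =
              copies #|reps| (complete_bipartite d d) q z.
  by rewrite -!embed_adj e.
(* Testing against a vertex opposite [q] in its own copy puts [p] in the same copy and on the same
   side. *)
have := adjE (q.1, if side q.2 then inr (Ordinal d_gt0) else inl (Ordinal d_gt0)).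
case: p q e {adjE} => [i s] [j t] /= e.
rewrite /copies_adj /= eqxx /=.
case: s t e => a [] b /= e; rewrite ?andbF // andbT => /eqP ij; subst j;
  congr (_, _); move: e => /eqP; rewrite nth_uniq ?enum_uniq -?cardE ?card_part //;
  by move=> /eqP /val_inj ->.
Qed.

Lemma twin_regular_copies :
  exists m, isomorphic G (copies m (complete_bipartite d d)).
Proof.
have surj v : exists p, embed p = v.
  have rR : rep v \in reps by apply: imset_f.
  have : same (rep v) v by rewrite -(same_left (rep_same v)) same_refl.
  have partP b : v \in part (rep v) b ->
      exists a : 'I_d, nth (rep v) (enum (part (rep v) b)) a = v.
    rewrite -mem_enum => vb; have := vb; rewrite -index_mem -cardE card_part.
    by move=> lt; exists (Ordinal lt); rewrite nth_index.
  rewrite /same; case/orP => sv.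
    have [|a av] := partP true; first by rewrite inE.
    by exists (enum_rank_in rR (rep v), inl a); rewrite /embed /= enum_rankK_in.
  have [|a av] := partP false; first by rewrite inE.
  by exists (enum_rank_in rR (rep v), inr a); rewrite /embed /= enum_rankK_in.
have [f fK] := choice surj.
exists #|reps|, f; split; last by move=> x y; rewrite -embed_adj !fK.
by exists embed => // p; apply: embed_inj; rewrite fK.
Qed.

End TwinGraphs.

Lemma degree_leq_max (V : finType) (G : sgraph V) (v : V) :
  (degree G v <= max_degree G)%N.
Proof. exact: leq_bigmax. Qed.

(** * Proportional rows and type 1 cycles in a gain graph *)

Section GainGraphRank.
Variables (R : realType) (n : nat) (G : gain_graph R n).
Local Notation A := (adjacency G).

Lemma quat_unitE (q : quat R) : (q \is a GRing.unit) = (q != 0).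
Proof. by []. Qed.

Lemma quat_unit (q : quat R) : q != 0 -> q \is a GRing.unit.
Proof. by rewrite quat_unitE. Qed.

Lemma gain_neq0 u v : G u v -> gain G u v != 0.
Proof.
move=> uv; have := gain_unit uv; apply: contraTneq => ->.
rewrite inE /Defs.normq mulq_conj /sqnormq /= expr0n /= !addr0 sqrtr0.
by rewrite eq_sym oner_eq0.
Qed.

Lemma adjacency_neq0 u v : (A u v != 0) = G u v.
Proof. by rewrite mxE; case: ifP => [/gain_neq0->|]; rewrite ?eqxx. Qed.

(** Columns [u2] and [u4] express the gains out of [u3] by [c] and the gains out of [u1]; in the
    cycle product everything then cancels. *)
Lemma proportional_rows_type1 u1 u2 u3 u4 c :
  four_cycle G u1 u2 u3 u4 -> row u3 A = c *: row u1 A -> type1 G u1 u2 u3 u4.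
Proof.
case/andP; rewrite /= andbT => /and4P[a12 a23 a34 a41] _ /rowP rc.
have a32 : G u3 u2 by rewrite adj_sym.
have a14 : G u1 u4 by rewrite adj_sym.
have := rc u2; have := rc u4; rewrite !mxE a34 a14 a32 a12 => e4 e2.
have c0 : c != 0.
  by apply: contraTneq (gain_neq0 a34) => c0; rewrite e4 c0 mul0r eqxx.
rewrite /type1 (gain_inv a23) (gain_inv a41) e2 e4.
rewrite invrM ?quat_unit ?gain_neq0 //.
by rewrite !mulrA divrr ?quat_unit ?gain_neq0 // mul1r mulVr ?quat_unit ?mul1r
  ?divrr ?quat_unit ?gain_neq0.
Qed.

Lemma type1_proportional_rows u v w :
  (forall u1 u2 u3 u4, four_cycle G u1 u2 u3 u4 -> type1 G u1 u2 u3 u4) ->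
  G u =1 G v -> G u w -> exists c, row u A = c *: row v A.
Proof.
move=> t1 uv uw; have vw : G v w by rewrite -uv.
have [->|unv] := eqVneq u v; first by exists 1; rewrite scale1r.
(* The factor is the gain of the path [u], [w], [v]; for another common neighbour [x], type 1 of the
   cycle [u], [w], [v], [x] is the required identity. *)
exists (gain G u w * gain G w v); apply/rowP => x; rewrite !mxE -uv.
case: ifP => [ux|_]; last by rewrite mulr0.
have wv : G w v by rewrite adj_sym.
have vx : G v x by rewrite -uv.
have [->|xw] := eqVneq x w.
  by rewrite (gain_inv wv) mulrVK ?quat_unit ?gain_neq0.
have xu : G x u by rewrite adj_sym.
have ne a b : G a b -> a != b by apply: contraTneq => ->; rewrite adj_irr.
have : type1 G u w v x.
  apply: t1; rewrite /four_cycle /ucycle /= uw wv vx xu /= !inE !negb_or.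
  by rewrite (ne _ _ uw) unv (ne _ _ ux) (ne _ _ wv) (ne _ _ vx) eq_sym xw.
rewrite /type1 (gain_inv xu) => e.
by rewrite -[RHS](mulrVK (quat_unit (gain_neq0 ux))) e mul1r.
Qed.

Hypothesis no_isolated : forall v, ~ isolated G v.

Lemma has_neighbour v : exists w, G v w.
Proof.
by have /existsNP[w /negP] := @no_isolated v; rewrite negbK; exists w.
Qed.

Lemma max_degree_gt0 : (0 < n)%N -> (0 < max_degree G)%N.
Proof.
move=> n_gt0; pose v := Ordinal n_gt0; have [w vw] := has_neighbour v.
by apply: leq_trans (degree_leq_max G v); apply/card_gt0P; exists w; rewrite inE.
Qed.

(** * Edge count from a maximum independent set, and its equality case *)

Section MaximumIndependent.
Variable S : {set 'I_n}.
Hypotheses (indS : rows_left_independent A S) (cardS : #|S| = rank G).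

Lemma maximum_independent_dominates v : exists2 s, s \in S & G s v.
Proof.
have [w vw] := has_neighbour v.
have [c /rowP/(_ v)] := maximum_independent_spans quat_unit w indS cardS.
rewrite mxE summxE => e; apply: contrapT => nS.
have : A w v != 0 by rewrite adjacency_neq0 adj_sym.
rewrite e big1 ?eqxx // => s sS; rewrite 2!mxE.
suff /eqP-> : A s v == 0 by rewrite mulr0.
by apply/negPn; rewrite adjacency_neq0; apply/negP => sv; apply: nS; exists s.
Qed.

Let edge_count :
  (\sum_v \sum_(s in S) G s v = \sum_(s in S) degree G s)%N.
Proof.
rewrite exchange_big; apply: eq_bigr => s _ /=.
by rewrite /degree -sum1dep_card [RHS]big_mkcond; apply: eq_bigr => v _;
  case: (G s v).
Qed.

Let dominated v : (1 <= \sum_(s in S) G s v)%N.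
Proof.
by have [s sS sv] := maximum_independent_dominates v; rewrite (bigD1 s) //= sv.
Qed.

Lemma order_leq_rank_degree : (n <= rank G * max_degree G)%N.
Proof.
rewrite -cardS -sum_nat_const -{1}(card_ord n) -sum1_card.
apply: leq_trans (_ : \sum_v \sum_(s in S) G s v <= _)%N.
  exact: leq_sum.
by rewrite edge_count; apply: leq_sum => s _; exact: degree_leq_max.
Qed.

Hypothesis extremal : n = (rank G * max_degree G)%N.

(** The edge count lies between [n] and rank times maximum degree, so both bounds collapse. *)
Let extremal_sums : (\sum_(v < n) 1 = \sum_v \sum_(s in S) G s v)%N
  /\ (\sum_(s in S) degree G s = \sum_(s in S) max_degree G)%N.
Proof.
have le1 : (\sum_(v < n) 1 <= \sum_v \sum_(s in S) G s v)%N by apply: leq_sum.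
have le2 : (\sum_(s in S) degree G s <= \sum_(s in S) max_degree G)%N.
  by apply: leq_sum => s _; exact: degree_leq_max.
move: le1 le2; rewrite edge_count sum_nat_const cardS -extremal sum1_card card_ord.
by move=> *; split; apply/eqP; rewrite eqn_leq; apply/andP; split; lia.
Qed.

Lemma extremal_degree s : s \in S -> degree G s = max_degree G.
Proof.
have [_ /eqP] := extremal_sums.
(* Equal sums with termwise inequality force termwise equality. *)
rewrite (leqif_sum (fun s _ => conj (degree_leq_max G s) erefl)).2.
by move=> /forallP/(_ s)/implyP h /h /eqP.
Qed.

Lemma extremal_dominator_unique s t v :
  s \in S -> t \in S -> G s v -> G t v -> s = t.
Proof.
move=> sS tS sv tv; apply/eqP/negP => /negP st.
have [/eqP] := extremal_sums.
rewrite (leqif_sum (fun v _ => conj (dominated v) erefl)).2.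
move=> /forallP/(_ v)/implyP/(_ isT) /eqP.
by rewrite (bigD1 s) //= (bigD1 t) ?tS 1?eq_sym // sv tv.
Qed.

Lemma extremal_row_proportional w : exists2 s, s \in S
  & G w =1 G s /\ exists2 c, c != 0 & row w A = c *: row s A.
Proof.
have [c /rowP rw] := maximum_independent_spans quat_unit w indS cardS.
(* By uniqueness of the dominator, only the term of [s] survives in column [x]. *)
have one s x : s \in S -> G s x -> A w x = c s * A s x.
  move=> sS sx; have := rw x; rewrite mxE summxE (bigD1 s) //= 2!mxE big1 => [|t].
    by rewrite addr0 mxE => ->; rewrite !mxE.
  move=> /andP[tS ts]; rewrite !mxE; case: ifP => [tx|]; last by rewrite mulr0.
  by rewrite (extremal_dominator_unique tS sS tx sx) eqxx in ts.
have [u wu] := has_neighbour w; have [s sS su] := maximum_independent_dominates u.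
have cs0 : c s != 0.
  move: (wu); rewrite -adjacency_neq0 (one s) //; apply: contraNneq => ->.
  by rewrite mul0r.
have sub : [set x | G s x] \subset [set x | G w x].
  apply/subsetP => x; rewrite !inE => sx.
  rewrite -adjacency_neq0 (one s) //.
  have sx0 : A s x != 0 by rewrite adjacency_neq0.
  by rewrite -quat_unitE unitrMl; apply: quat_unit.
(* The neighbourhood of [s] already has the maximum size, so the inclusion is an equality. *)
have eN : [set x | G s x] = [set x | G w x].
  apply/eqP; rewrite eqEcard sub /=.
  by rewrite -/(degree G s) -/(degree G w) (extremal_degree sS) degree_leq_max.
have ws : G w =1 G s by move=> x; move/setP/(_ x): eN; rewrite !inE => ->.
exists s => //; split=> //; exists (c s) => //; apply/rowP => x.
rewrite [LHS]mxE [RHS]mxE [X in _ * X]mxE; case: (boolP (G s x)) => [/one->//|sx].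
by rewrite !mxE ws (negPf sx) mulr0.
Qed.

Lemma extremal_common_neighbour u v x : G u x -> G v x ->
  G u =1 G v /\ exists c, row u A = c *: row v A.
Proof.
have [s sS [us [c c0 ru]]] := extremal_row_proportional u.
have [t tS [vt [d d0 rv]]] := extremal_row_proportional v.
rewrite us vt => sx tx; have e := extremal_dominator_unique sS tS sx tx.
split=> [y|]; first by rewrite us vt e.
exists (c * d^-1); rewrite rv ru e scalerA mulrVK //; exact: quat_unit.
Qed.

Lemma extremal_regular v : degree G v = max_degree G.
Proof.
have [s sS [vs _]] := extremal_row_proportional v.
by rewrite -(extremal_degree sS); apply: eq_card => x; rewrite !inE vs.
Qed.

End MaximumIndependent.

Lemma copies_type1_rank_leq m d :
  isomorphic G (copies m (complete_bipartite d d)) ->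
  (forall u1 u2 u3 u4, four_cycle G u1 u2 u3 u4 -> type1 G u1 u2 u3 u4) ->
  (rank G <= m * 2)%N.
Proof.
move=> [f [bijf adjf]] t1.
have [S indS cardS] := left_rank_witness A; rewrite /rank -cardS.
(* Copy and side of [v]: vertices agreeing in both are twins, so type 1 makes their rows
   proportional and [S] contains at most one of them. *)
pose g v : 'I_m * bool := ((f v).1, if (f v).2 is inl _ then true else false).
have inj_g : {in S &, injective g}.
  move=> u v uS vS [e1 e2].
  have uv : G u =1 G v.
    move=> x; rewrite -!adjf /= /copies_adj /= e1; congr (_ && _).
    by move: e2; case: (f u).2; case: (f v).2 => //; case: (f x).2.
  have [w uw] := has_neighbour u; have [c rc] := type1_proportional_rows t1 uv uw.
  exact: independent_rows_not_proportional indS uS vS rc.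
rewrite -(card_in_imset inj_g); apply: leq_trans (max_card _) _.
by rewrite card_prod card_ord card_bool.
Qed.

End GainGraphRank.

Theorem theorem3p3 (R : realType) (n : nat) (G : gain_graph R n)
    (n_gt0 : (0 < n)%N) (no_isolated : forall v : 'I_n, ~ isolated G v) :
  (rank G)%:R = n%:R / (max_degree G)%:R :> rat
  <->
  (exists m : nat,
      m%:R = n%:R / (2 * (max_degree G)%:R) :> rat
      /\ isomorphic G
           (copies m (complete_bipartite (max_degree G) (max_degree G))))
  /\ (forall u1 u2 u3 u4 : 'I_n,
        four_cycle G u1 u2 u3 u4 -> type1 G u1 u2 u3 u4).
Proof.
have d_gt0 := max_degree_gt0 no_isolated n_gt0.
(* Clears denominators, so that only equations in [nat] remain. *)
have divE a b : (0 < b)%N -> a%:R = n%:R / b%:R :> rat <-> n = (a * b)%N.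
  move=> b_gt0; have b0 : b%:R != 0 :> rat by rewrite pnatr_eq0 -lt0n.
  split=> [e|->]; last by rewrite natrM mulfK.
  by apply/eqP; rewrite -(eqr_nat rat) natrM e mulfVK.
have [S indS cardS] := left_rank_witness (adjacency G).
rewrite divE //; split=> [ext|[[m []]]].
  have common := extremal_common_neighbour no_isolated indS cardS ext.
  split.
    have [m iso] := twin_regular_copies d_gt0
      (extremal_regular no_isolated indS cardS ext)
      (fun u v x ux vx => (common u v x ux vx).1).
    exists m; split=> //; rewrite -natrM divE ?muln_gt0 //.
    (* Counting vertices on both sides of the isomorphism determines [m]. *)
    have [f [/bij_eq_card]] := iso.
    by rewrite card_prod card_sum !card_ord addnn mul2n.
  move=> u1 u2 u3 u4 cyc; have /andP[] := cyc.
  rewrite /= andbT => /and4P[a12 a23 _ _] _.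
  (* Opposite vertices [u1] and [u3] share the neighbour [u2]. *)
  have [|_ [c rc]] := common u3 u1 u2 _ a12; first by rewrite adj_sym.
  exact: proportional_rows_type1 cyc rc.
rewrite -natrM divE ?muln_gt0 // => nE iso t1.
(* One inequality is the edge count; the other is rank at most [m * 2], multiplied by the maximum
   degree. *)
apply/eqP; rewrite eqn_leq (order_leq_rank_degree no_isolated indS cardS) /=.
by rewrite [leqRHS]nE mulnA leq_mul2r (copies_type1_rank_leq no_isolated iso t1) orbT.
Qed.
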